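(* Let $H$ be a graph and $\sigma:E(H)\to SI_5$ a capacity function on $H$. Suppose that $P_1$ and $P_2$ are distinct paths in $H$ with $\sigma(e)=(4,1)$ for every $e\in E(P_1)\cup E(P_2)$. Assume that each internal vertex of these paths has degree $3$ in $H$ and that, for $i=1,2$, $\sigma(e)\subseteq(1,4)$ for every edge $e\notin E(P_i)$ incident to an internal vertex of $P_i$. If two internal vertices of $P_1$ at even distance on $P_1$ are adjacent, respectively, to two internal vertices of $P_2$ at odd distance on $P_2$, i.e. there exist two edges not in $P_1\cup P_2$ connecting two internal vertices of $P_1$ to two internal vertices of $P_2$ and forming an odd cycle with some edges of $P_1$ and $P_2$, then $\Phi_c(G)\ge 5$ for all $G\in H^\sigma$.
   Context: Graphs are finite and may have multiple edges. Circular flow number: for real $r\ge 2$, a circular nowhere-zero $r$-flow in a graph $G$ is an orientation of $G$ together with a real-valued flow (inflow equals outflow at every vertex) such that the value on each edge lies in $[1,r-1]$. The circular flow number $\Phi_c(G)$ is the infimum of the reals $r$ such that $G$ has a circular nowhere-zero $r$-flow ($+\infty$ if there is none). Intervals: $\mathbb{R}/5\mathbb{Z}$ is viewed as a circle of length $5$. For $a\neq b$ in $\mathbb{R}/5\mathbb{Z}$, $(a,b)$ denotes the open arc traversed clockwise (increasing direction) from $a$ to $b$, and $(x,x)=\mathbb{R}/5\mathbb{Z}\setminus\{x\}$; for instance $(4,1)$ is the open arc of length $2$ containing $0$. $I_5$ is the set of all $(a,b)$ with $a,b$ integers modulo $5$. A set $X\subseteq\mathbb{R}/5\mathbb{Z}$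 is symmetric if $x\in X\iff -x\in X$. $SI_5$ is the family of all symmetric subsets of $\mathbb{R}/5\mathbb{Z}$ that are unions of (possibly no) elements of $I_5$. Generalised edges: a generalised edge $G_{xy}$ is a graph $G$ with at least two vertices together with two distinct vertices $x,y$, its terminals. $G_{xy}^+$ is obtained from $G_{xy}$ by adding a new edge $e^+=xy$. The open $5$-capacity is $CP_5(G_{xy})=\{f(e^+): f \text{ is a modulo-}5\text{ flow in } G_{xy}^+ \text{ (for some orientation) with } f(e)\in(1,4) \text{ for every } e\in E(G)\}$, where a modulo-$5$ flow takes values in $\mathbb{R}/5\mathbb{Z}$ and satisfies conservation modulo $5$ at every vertex. It is always an element of $SI_5$. For $A\in SI_5$, an $A$-edge is a generalised edge with $CP_5=A$ (a single ordinary edge is a $(1,4)$-edge). Families: for a graph $H$ and a capacity function $\sigma:E(H)\to SI_5$, $H^\sigma$ is the family of all graphs obtained from $H$ by replacing every edge $uv$ by a $\sigma(uv)$-edge with terminals $u$ and $v$ (the replacing generalised edges being disjoint from each other except possibly at terminals). *)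

(* Defs.v *)
From HB Require Import structures.
From mathcomp Require Import all_boot all_order all_algebra.
From mathcomp Require Import generic_quotient ring_quotient.
From mathcomp Require Import boolp classical_sets reals constructive_ereal ereal.

Set Implicit Arguments.
Unset Strict Implicit.
Unset Printing Implicit Defensive.

Import Order.TTheory GRing.Theory Num.Theory.

Local Open Scope classical_set_scope.
Local Open Scope ring_scope.

Definition multZ5 (R : realType) : {pred R} :=
  fun x : R => x / 5%:R \is a Num.int.

Lemma multZ5_zmod_closed (R : realType) : zmod_closed (@multZ5 R).
Proof.
have E (x : R) : (x \in @multZ5 R) = (x / 5%:R \is a Num.int) by [].
split=> [|x y]; rewrite !E ?mul0r ?rpred0 // => hx hy.
by rewrite mulrBl rpredB.
Qed.

HB.instance Definition _ (R : realType) :=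
  GRing.isZmodClosed.Build R (@multZ5 R) (@multZ5_zmod_closed R).

Definition circle5 (R : realType) : zmodType := Quotient.quot (@multZ5 R).

Definition mod5 (R : realType) (x : R) : circle5 R :=
  (\pi_(Quotient.quot (@multZ5 R)) x)%qT.

(* Since beta - alpha is congruent to b - a, the condition beta <= alpha + 5
   forces beta to be the first representative of b met after alpha; when a = b
   it gives beta = alpha + 5, so that open_arc a a is the complement of a. *)
Definition open_arc (R : realType) (a b : circle5 R) : set (circle5 R) :=
  [set x | exists alpha xi beta : R,
     [/\ mod5 alpha = a, mod5 xi = x & mod5 beta = b] /\
     [/\ alpha < xi, xi < beta & beta <= alpha + 5%:R]].

Definition int_arc (R : realType) (a b : int) : set (circle5 R) :=
  open_arc (mod5 a%:~R) (mod5 b%:~R).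
Arguments int_arc R a b : clear implicits.

Definition I5 (R : realType) : set (set (circle5 R)) :=
  [set A | exists a b : int, A = int_arc R a b].

Definition symmetric_set (R : realType) (X : set (circle5 R)) : Prop :=
  forall x, X x <-> X (- x).

Definition SI5 (R : realType) : set (set (circle5 R)) :=
  [set X | symmetric_set X /\
     exists2 F : set (set (circle5 R)), F `<=` @I5 R & X = \bigcup_(A in F) A].

(* Finite undirected multigraphs: the order of the two ends of an edge is an
   artefact of the encoding. Loops are allowed. *)
Record graph := Graph {
  vert : finType;
  edge : finType;
  ends : edge -> vert * vert
}.

Definition joins (G : graph) (e : edge G) (u v : vert G) : bool :=
  (ends e == (u, v)) || (ends e == (v, u)).

Definition incident (G : graph) (e : edge G) (v : vert G) : bool :=
  ((ends e).1 == v) || ((ends e).2 == v).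

(* A loop counts twice. *)
Definition degree (G : graph) (v : vert G) : nat :=
  (#|[pred e : edge G | (ends e).1 == v]| + #|[pred e : edge G | (ends e).2 == v]|)%N.

Definition graph_iso (G G' : graph) : Prop :=
  exists (fV : vert G -> vert G') (fE : edge G -> edge G'),
    [/\ bijective fV, bijective fE &
        forall e, joins (fE e) (fV (ends e).1) (fV (ends e).2)].

(* o e = true directs e from its first to its second end. *)
Definition orientation (G : graph) := edge G -> bool.

Definition edge_tail (G : graph) (o : orientation G) (e : edge G) : vert G :=
  if o e then (ends e).1 else (ends e).2.

Definition edge_head (G : graph) (o : orientation G) (e : edge G) : vert G :=
  if o e then (ends e).2 else (ends e).1.

Definition flow (A : zmodType) (G : graph) (o : orientation G)
    (f : edge G -> A) : Prop :=
  forall v, \sum_(e | edge_head o e == v) f e = \sum_(e | edge_tail o e == v) f e.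

Definition has_circular_nzflow (R : realType) (G : graph) (r : R) : Prop :=
  exists (o : orientation G) (f : edge G -> R),
    flow o f /\ forall e, 1 <= f e <= r - 1.

Definition Phi_c (R : realType) (G : graph) : \bar R :=
  ereal_inf [set r%:E | r in [set r : R | 2%:R <= r /\ has_circular_nzflow G r]].
Arguments Phi_c R G : clear implicits.

Record gedge := GEdge {
  ggraph :> graph;
  gx : vert ggraph;
  gy : vert ggraph;
  gx_neq_gy : gx != gy
}.

(* None is the additional edge e^+. *)
Definition gplus (K : gedge) : graph :=
  @Graph (vert K) (option (edge K))
    (fun e => if e is Some e' then ends e' else (gx K, gy K)).

Definition CP5 (R : realType) (K : gedge) : set (circle5 R) :=
  [set c | exists (o : orientation (gplus K)) (f : edge (gplus K) -> circle5 R),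
     [/\ flow o f, forall e : edge K, int_arc R 1 4 (f (Some e)) & f None = c]].
Arguments CP5 R K : clear implicits.

Section Replacement.
Variables (H : graph) (K : edge H -> gedge).

Definition inner_vert (e : edge H) : finType :=
  {z : vert (K e) | (z != gx (K e)) && (z != gy (K e))}.

Definition repl_vert : finType := (vert H + {e : edge H & inner_vert e})%type.

Definition repl_emb (e : edge H) (z : vert (K e)) : repl_vert :=
  if insub z is Some w then inr (Tagged inner_vert (w : inner_vert e))
  else inl (if z == gx (K e) then (ends e).1 else (ends e).2).

Definition replace : graph :=
  @Graph repl_vert {e : edge H & edge (K e)}
    (fun p => (repl_emb (ends (tagged p)).1, repl_emb (ends (tagged p)).2)).

End Replacement.

(* The family H^sigma, closed under isomorphism. Matching the terminals gx, gy
   with the ends of e in the listed order is no restriction, since the two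
   terminals of a generalised edge may be exchanged without changing CP5. *)
Definition in_family (R : realType) (H : graph)
    (sigma : edge H -> set (circle5 R)) (G : graph) : Prop :=
  exists K : edge H -> gedge,
    (forall e, CP5 R (K e) = sigma e) /\ graph_iso (replace K) G.

Record gpath (G : graph) := GPath {
  plen : nat;
  pvert : 'I_plen.+1 -> vert G;
  pedge : 'I_plen -> edge G;
  pvert_inj : injective pvert;
  pedge_joins : forall i : 'I_plen,
    joins (pedge i) (pvert (widen_ord (leqnSn plen) i)) (pvert (lift ord0 i))
}.

Definition path_verts (G : graph) (P : gpath G) : {set vert G} :=
  [set pvert i | i : 'I_(plen P).+1].

Definition path_edges (G : graph) (P : gpath G) : {set edge G} :=
  [set pedge i | i : 'I_(plen P)].

(* Paths are compared as subgraphs: a path and its reversal are the same. *)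
Definition path_subgraph (G : graph) (P : gpath G) : {set vert G} * {set edge G} :=
  (path_verts P, path_edges P).

Definition internal (G : graph) (P : gpath G) (v : vert G) : Prop :=
  exists2 i : 'I_(plen P).+1, (0 < i < plen P)%N & pvert i = v.

Definition path_dist (G : graph) (P : gpath G) (u v : vert G) (d : nat) : Prop :=
  exists i j : 'I_(plen P).+1,
    [/\ pvert i = u, pvert j = v & d = `|i - j|%N].

(* Main.v *)
Require Import Defs.
From HB Require Import structures.
From mathcomp Require Import all_boot all_order all_algebra.
From mathcomp Require Import boolp classical_sets reals constructive_ereal ereal.
From mathcomp Require Import generic_quotient ring_quotient ring lra zify.

(** A circular nowhere-zero r-flow on G with r < 5 can be rescaled so that all
    its values lie strictly between 1 and 4. Such a real flow induces a real
    flow c on H: the value c e is what the generalised edge replacing e carries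
    from its first terminal to its second. Adding an edge that returns this
    amount closes the flow inside the generalised edge, so c e modulo 5 belongs,
    up to sign, to the open 5-capacity sigma e, and symmetry of sigma e removes
    the sign ([family_circulation]). It remains to see that H has no such flow.

    Along P1 or P2 every value of c is modulo 5 in (-1,1). At an internal vertex
    exactly one further edge leaves the path, carrying the difference x - y of
    the incoming path value x and the outgoing one y, and this difference is in
    (1,4) modulo 5. Since it also lies in (-2,2), it is in (1,2) or in (-2,-1):
    thus x and y are nonzero with opposite signs, and the sign of x is that of
    the flow leaving the path ([arc5_split]). So the signs of the path edges
    alternate, and so do the signs of the flows leaving the path at consecutive
    internal vertices ([path_alternates]). An edge that joins an internal
    vertex of P1 to one of P2 leaves the first with a sign opposite to that with
    which it leaves the second. Two such edges force the two distances, along P1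
    and along P2, to have the same parity, which is the contradiction.

    All flows are handled as signed functions for the reference orientation
    given by the listed ends, conservation being the vanishing of the net
    outflow. The flow on H stays real-valued, so that conservation there is an
    identity of real numbers; only the positions of its values on the circle are
    read modulo 5, through [arc5]. *)

Set Implicit Arguments.
Unset Strict Implicit.
Unset Printing Implicit Defensive.

Import Order.TTheory GRing.Theory Num.Theory.

Local Open Scope classical_set_scope.
Local Open Scope ring_scope.

(** * Flows as signed edge functions *)

Section Circulations.
Variable V : zmodType.

(** A difference of two tests rather than a single choice, so that a loop
    contributes nothing. *)
Definition edge_outflow (G : graph) (g : edge G -> V) (e : edge G)
    (v : vert G) : V :=
  (if (ends e).1 == v then g e else 0) - (if (ends e).2 == v then g e else 0).

Definition net_outflow (G : graph) (g : edge G -> V) (v : vert G) : V :=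
  \sum_e edge_outflow g e v.

Definition signed (G : graph) (o : orientation G) (f : edge G -> V)
    (e : edge G) : V :=
  if o e then f e else - f e.

Lemma flowE (G : graph) (o : orientation G) (f : edge G -> V) :
  flow o f <-> forall v, net_outflow (signed o f) v = 0.
Proof.
suff E v : net_outflow (signed o f) v =
    \sum_(e | edge_tail o e == v) f e - \sum_(e | edge_head o e == v) f e.
  split=> h v; first by rewrite E h subrr.
  by apply/esym/eqP; rewrite -subr_eq0 -E h.
rewrite [X in X - _]big_mkcond [X in _ - X]big_mkcond -sumrB.
apply: eq_bigr => e _; rewrite /edge_outflow /signed /edge_tail /edge_head.
case: (o e) => //; rewrite [RHS]addrC.
by congr (_ + _); case: eqP; rewrite ?oppr0 ?opprK.
Qed.

Lemma sum_fiber_point (T : finType) (W : eqType) (h : T -> W) (w : W)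
    (a : T) (x : V) :
  \sum_(v | h v == w) (if a == v then x else 0) = if h a == w then x else 0.
Proof.
case: ifP => hw; last first.
  by rewrite big1 // => v hv; case: eqP => // av; rewrite av hv in hw.
rewrite (bigD1 a) //= eqxx big1 ?addr0 // => v /andP[_ nv].
by rewrite eq_sym (negPf nv).
Qed.

(** Net outflows add up along any map h of the vertices, since the two
    half-edges of each edge are simply redistributed over the images. Applied to
    a constant map it gives the vanishing total, and applied to the embedding of
    a generalised edge it computes the outflow after replacement. *)
Lemma net_outflow_push (G : graph) (g : edge G -> V) (W : eqType)
    (h : vert G -> W) (w : W) :
  \sum_(v | h v == w) net_outflow g v =
  \sum_e ((if h (ends e).1 == w then g e else 0) -
          (if h (ends e).2 == w then g e else 0)).
Proof.
rewrite exchange_big /=; apply: eq_bigr => e _.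
by rewrite sumrB !sum_fiber_point.
Qed.

Lemma net_outflow_total (G : graph) (g : edge G -> V) :
  \sum_v net_outflow g v = 0.
Proof.
transitivity (\sum_(v | tt == tt) net_outflow g v); first exact: eq_bigl.
by rewrite (net_outflow_push g (fun=> tt)) big1 // => e _; exact: subrr.
Qed.

Lemma edge_outflow_joins (G : graph) (g : edge G -> V) (e : edge G)
    (u v : vert G) :
  joins e u v -> edge_outflow g e u = - edge_outflow g e v.
Proof.
by rewrite /joins /edge_outflow => /orP[] /eqP -> /=;
  rewrite !eqxx [v == u]eq_sym opprB.
Qed.

Lemma edge_outflow_nonincident (G : graph) (g : edge G -> V) (e : edge G) v :
  ~~ incident e v -> edge_outflow g e v = 0.
Proof.
by rewrite /incident /edge_outflow negb_or => /andP[/negPf -> /negPf ->]; rewrite subr0.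
Qed.

Lemma joins_incident (G : graph) (e : edge G) u v :
  joins e u v -> incident e u && incident e v.
Proof. by rewrite /joins /incident => /orP[] /eqP -> /=; rewrite !eqxx ?orbT. Qed.

(** An isomorphism may swap the two listed ends of an edge; the sign of the
    flow value is changed on those edges. *)
Lemma circulation_iso (G G' : graph) (g : edge G' -> V) :
  graph_iso G G' -> (forall v, net_outflow g v = 0) ->
  exists g' : edge G -> V, (forall v, net_outflow g' v = 0) /\
    forall e, exists e', g' e = g e' \/ g' e = - g e'.
Proof.
case=> fV [fE [bV bE jE]] g0.
pose g' e := if ends (fE e) == (fV (ends e).1, fV (ends e).2)
             then g (fE e) else - g (fE e).
exists g'; split=> [v|e]; last first.
  by exists (fE e); rewrite /g'; case: ifP => _; [left|right].
rewrite -[RHS](g0 (fV v)) [RHS](reindex fE (onW_bij _ bE)).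
apply: eq_bigr => e _; rewrite /edge_outflow /g'.
have := jE e; rewrite /joins; case: eqP => [-> _ | _ /= /eqP ->] /=;
  rewrite !(inj_eq (bij_inj bV)) //.
by do 2 case: eqP => _; rewrite ?subr0 ?sub0r ?opprK ?addr0 ?subrr ?addNr ?oppr0.
Qed.

End Circulations.

(** * From a replaced graph back to the base graph *)

Section Replace.
Variable V : zmodType.
Variables (H : graph) (K : edge H -> gedge) (g : edge (replace K) -> V).

Definition block (e : edge H) (k : edge (K e)) : V :=
  g (Tagged (fun e => edge (K e)) k).

Definition transfer (e : edge H) : V := net_outflow (@block e) (gx (K e)).

Lemma repl_emb_inner (e : edge H) (z : vert (K e))
    (hz : (z != gx (K e)) && (z != gy (K e))) :
  repl_emb z = inr (Tagged (inner_vert K) (exist _ z hz)).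
Proof.
rewrite /repl_emb; case: insubP => [w _ ew|]; last by rewrite hz.
by congr (inr (Tagged _ _)); apply: val_inj.
Qed.

Lemma repl_emb_gx (e : edge H) : repl_emb (gx (K e)) = inl (ends e).1.
Proof. by rewrite /repl_emb insubF ?eqxx. Qed.

Lemma repl_emb_gy (e : edge H) : repl_emb (gy (K e)) = inl (ends e).2.
Proof. by rewrite /repl_emb insubF ?eqxx ?andbF // eq_sym (negPf (gx_neq_gy _)). Qed.

(** Every edge of the replaced graph lies in exactly one block, so its net
    outflow at w collects the net outflows of the blocks at the preimages of
    w. *)
Lemma net_outflow_replace (w : repl_vert K) :
  net_outflow g w = \sum_e \sum_(z | repl_emb z == w) net_outflow (@block e) z.
Proof.
rewrite /net_outflow.
under [RHS]eq_bigr do rewrite net_outflow_push.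
rewrite (sig_big_dep (fun=> true) (fun=> xpredT) (fun (e : edge H) (k : edge (K e)) =>
  (if repl_emb (ends k).1 == w then block k else 0) -
  (if repl_emb (ends k).2 == w then block k else 0))) /=.
by apply: eq_bigr => [[e k]] _.
Qed.

Hypothesis g0 : forall w, net_outflow g w = 0.

(** A non-terminal vertex of a block meets no other block, so conservation
    there is conservation inside the block. *)
Lemma block_inner (e : edge H) (z : vert (K e)) :
  z != gx (K e) -> z != gy (K e) -> net_outflow (@block e) z = 0.
Proof.
move=> zx zy; have hz : (z != gx (K e)) && (z != gy (K e)) by rewrite zx.
have := g0 (repl_emb z); rewrite net_outflow_replace (bigD1 e) //=.
rewrite [X in _ + X]big1 ?addr0 => [|e' ne]; last first.
  rewrite big1 // => z' /eqP; rewrite (repl_emb_inner hz).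
  rewrite /repl_emb; case: insubP => // w _ _ [] /= ee.
  by rewrite ee eqxx in ne.
rewrite (bigD1 z) //= big1 ?addr0 // => z' /andP[/eqP + nz].
rewrite (repl_emb_inner hz) /repl_emb; case: insubP => // w _ ew [] /= ee.
move: (eq_from_Tagged ee) => /= wE; move: ew; rewrite wE /= => zz.
by rewrite zz eqxx in nz.
Qed.

(** Net outflows inside a block sum to zero, and only the terminals
    contribute. *)
Lemma block_gy (e : edge H) : net_outflow (@block e) (gy (K e)) = - transfer e.
Proof.
apply/eqP; rewrite -addr_eq0 addrC /transfer; apply/eqP.
rewrite -[RHS](net_outflow_total (@block e)) (bigD1 (gx (K e))) //=.
congr (_ + _); rewrite (bigD1 (gy (K e))) ?[gy _ == _]eq_sym ?gx_neq_gy //=.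
by rewrite big1 ?addr0 // => z /andP[]; exact: block_inner.
Qed.

Lemma net_outflow_block (e : edge H) (z : vert (K e)) :
  net_outflow (@block e) z = (if gx (K e) == z then transfer e else 0) -
                             (if gy (K e) == z then transfer e else 0).
Proof.
have [<-|zx] := eqVneq; first by rewrite eq_sym (negPf (gx_neq_gy _)) subr0.
have [<-|zy] := eqVneq; first by rewrite block_gy sub0r.
by rewrite subr0 block_inner // eq_sym.
Qed.

Lemma transfer_circulation (u : vert H) : net_outflow transfer u = 0.
Proof.
rewrite -[RHS](g0 (inl u)) net_outflow_replace; apply: eq_bigr => e _.
under [RHS]eq_bigr do rewrite net_outflow_block.
by rewrite sumrB !sum_fiber_point repl_emb_gx repl_emb_gy.
Qed.

End Replace.

(** * Arcs of the circle of length 5 *)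

Section Circle.
Variable R : realType.
Implicit Types x y : R.

HB.instance Definition _ :=
  GRing.isZmodMorphism.Build R (circle5 R) (@mod5 R)
    (pi_is_zmod_morphism (Quotient.quot (@multZ5 R))).

Lemma mod5_eq x y : mod5 x = mod5 y -> exists k : int, x = y + 5%:R * k%:~R.
Proof.
move=> exy; have : (x - y) \in @multZ5 R.
  by rewrite Quotient.idealrBE; apply/eqP.
rewrite /multZ5 unfold_in => /intrP[k hk]; exists k.
by rewrite -hk; field.
Qed.

Lemma mod5_period x (k : int) : mod5 (x + 5%:R * k%:~R) = mod5 x.
Proof.
apply/eqP; rewrite /mod5 -Quotient.idealrBE addrAC subrr add0r.
by rewrite /multZ5 unfold_in mulrAC divff ?mul1r ?intr_int // pnatr_eq0.
Qed.

(** The class of x modulo 5 lies in the open arc from a to b; phrasing it on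
    real representatives lets linear arithmetic decide the sign arguments. *)
Definition arc5 (a b x : R) : Prop :=
  exists k : int, a < x + 5%:R * k%:~R < b.

(** The condition on a and b makes them consecutive representatives of the
    two endpoints. The lifts in the definition of the arc satisfy the same
    condition, so they are a translate of a and b by one multiple of 5. *)
Lemma int_arcP (a b : int) x : (a < b <= a + 5)%R ->
  int_arc R a b (mod5 x) <-> arc5 a%:~R b%:~R x.
Proof.
case/andP=> ab ba; split; last first.
  case=> k /andP[h1 h2]; exists a%:~R, (x + 5%:R * k%:~R), b%:~R.
  rewrite mod5_period; split; split=> //.
  by rewrite -(ler_int R) rmorphD /= in ba.
case=> al [xi [be [[ha hx hb] [h1 h2 h3]]]].
have [k ka] := mod5_eq ha; have [n nx] := mod5_eq hx; have [m mb] := mod5_eq hb.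
have km : m = k.
  have l1 : ((a + 5 * k)%:~R : R) < (b + 5 * m)%:~R.
    by rewrite !rmorphD !rmorphM /= -ka -mb; lra.
  have l2 : ((b + 5 * m)%:~R : R) <= (a + 5 * k + 5)%:~R.
    by rewrite !rmorphD !rmorphM /= -ka -mb.
  by rewrite ltr_int in l1; rewrite ler_int in l2; lia.
by exists (n - k); rewrite rmorphB /=; subst m; lra.
Qed.

Lemma arc5_shift (k : int) a b x :
  arc5 (a + 5%:R * k%:~R) (b + 5%:R * k%:~R) x <-> arc5 a b x.
Proof.
split=> -[m hm]; [exists (m - k) | exists (m + k)];
  by rewrite ?rmorphB ?rmorphD /=; lra.
Qed.

Lemma arc5N a b x : arc5 a b (- x) <-> arc5 (- b) (- a) x.
Proof. by split=> -[k hk]; exists (- k); rewrite rmorphN /=; lra. Qed.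

Lemma arc5_14 x : int_arc R 1 4 (mod5 x) <-> arc5 1 4%:R x.
Proof. exact: (@int_arcP 1 4). Qed.

Lemma arc5_41 x : int_arc R 4 1 (mod5 x) <-> arc5 (-1) 1 x.
Proof.
(* The first representative of 1 met after 4 is 6. *)
have -> : int_arc R 4 1 = int_arc R 4 6.
  by rewrite /int_arc -(mod5_period 1%:~R 1); congr (open_arc _ (mod5 _)); ring.
rewrite (@int_arcP 4 6) // -(arc5_shift 1 (-1)).
have [-> ->] : -1 + 5%:R * 1%:~R = 4%:~R :> R /\ 1 + 5%:R * 1%:~R = 6%:~R :> R by split; ring.
by [].
Qed.

Lemma arc5_14_sign (b : bool) x : arc5 1 4%:R ((-1) ^+ b * x) <-> arc5 1 4%:R x.
Proof.
case: b; rewrite ?expr0 ?mul1r // mulN1r arc5N -(arc5_shift 1).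
have [-> ->] : - 4%:R + 5%:R * 1%:~R = 1 :> R /\ -1 + 5%:R * 1%:~R = 4%:R :> R by split; ring.
by [].
Qed.

Lemma arc5_41_sign (b : bool) x : arc5 (-1) 1 ((-1) ^+ b * x) <-> arc5 (-1) 1 x.
Proof. by case: b; rewrite ?expr0 ?mul1r // mulN1r arc5N opprK. Qed.

(** The trichotomy at an internal vertex of a path: x arrives along the path, y
    goes on along it, and x - y leaves it. With representatives of x and y in
    (-1,1) the difference lies in (-2,2), so it can meet a translate of (1,4)
    only in (1,2) or in (-2,-1); in both cases x and y are pulled to opposite
    sides of zero. The boolean b is true when x is on the negative
    side. *)
Lemma arc5_split x y :
  arc5 (-1) 1 x -> arc5 (-1) 1 y -> arc5 1 4%:R (x - y) ->
  exists b : bool,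
    [/\ arc5 0 1 ((-1) ^+ b * x), arc5 0 1 ((-1) ^+ (~~ b) * y)
      & arc5 1 2%:R ((-1) ^+ b * (x - y))].
Proof.
case=> k hk [m hm] [n hn].
(* The shift aligning x - y with (1,4) differs by 0 or 1 from the one induced
   by the representatives of x and y, as 5(k - m - n) lies in (-6,1). *)
have [nE|nE] : n = k - m \/ n = k - m + 1.
  have l1 : ((5 * (k - m - n))%:~R : R) < (1)%:~R.
    by rewrite !(rmorphM, rmorphB, rmorphD) /=; lra.
  have l2 : ((-6)%:~R : R) < (5 * (k - m - n))%:~R.
    by rewrite !(rmorphM, rmorphB, rmorphD) /=; lra.
  by rewrite !ltr_int in l1 l2; lia.
- rewrite nE rmorphB /= in hn.
  exists false; rewrite !expr0 !mul1r mulN1r; split.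
  + by exists k; lra.
  + by exists (- m); rewrite rmorphN /=; lra.
  + by exists (k - m); rewrite rmorphB /=; lra.
- rewrite nE rmorphD rmorphB /= in hn.
  exists true; rewrite !expr0 !mul1r !mulN1r; split.
  + by exists (- k); rewrite rmorphN /=; lra.
  + by exists m; lra.
  + by exists (m - k); rewrite rmorphB /=; lra.
Qed.

(** An arc contained in (0,5/2) is disjoint from its opposite: an element of
    both would give a multiple of 5 strictly between 0 and 5. *)
Lemma arc5_sign_inj (a b x : R) (s t : bool) :
  0 <= a -> b + b <= 5%:R ->
  arc5 a b ((-1) ^+ s * x) -> arc5 a b ((-1) ^+ t * x) -> s = t.
Proof.
move=> a0 b5; have [//|st] := eqVneq s t.
have -> : t = ~~ s by case: s t st => [] [].
rewrite signrN mulNr; case=> k hk [m hm]; exfalso.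
have l1 : ((5 * (k + m))%:~R : R) < 5%:~R.
  by rewrite !(rmorphM, rmorphD) /=; lra.
have l2 : (0%:~R : R) < (5 * (k + m))%:~R.
  by rewrite !(rmorphM, rmorphD) /=; lra.
by rewrite !ltr_int in l1 l2; lia.
Qed.

End Circle.

(** * From circular flows to capacities *)

Section Lifting.
Variable R : realType.

(** Since r < 5, there is room to stretch the interval [1, r - 1] by a factor
    s > 1 and stay strictly below 4. *)
Lemma mod14_circulation (G : graph) (r : R) :
  2%:R <= r -> r < 5%:R -> has_circular_nzflow G r ->
  exists g : edge G -> R,
    (forall v, net_outflow g v = 0) /\ forall e, arc5 1 4%:R (g e).
Proof.
move=> r2 r5 [o [f [/flowE f0 fr]]].
(* Both s > 1 and s (r - 1) < 4 are equivalent to r < 5 for this s. *)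
pose s := 8%:R / (r + 3%:R).
have s0 : 0 < s by rewrite divr_gt0 //; lra.
have s1 : 1 < s by rewrite ltr_pdivlMr; lra.
have s4 : s * (r - 1) < 4%:R by rewrite mulrAC ltr_pdivrMr; lra.
exists (fun e => s * signed o f e); split=> [v|e].
- rewrite -[RHS](mulr0 s) -[in RHS](f0 v) /net_outflow mulr_sumr.
  apply: eq_bigr => e _; rewrite /edge_outflow.
  by rewrite mulrBr; congr (_ - _); case: ifP; rewrite ?mulr0.
- have /andP[f1 f2] := fr e.
  have h1 : 1 < s * f e by rewrite (lt_le_trans s1) // ler_peMr // ltW.
  have h2 : s * f e < 4%:R by rewrite (le_lt_trans _ s4) // ler_pM2l.
  rewrite -(arc5_14_sign (~~ o e)) /signed; exists 0; rewrite mulr0 addr0.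
  by case: (o e); rewrite /= ?expr0 ?mul1r ?mulN1r ?mulrN ?opprK h1.
Qed.

(** The added edge, directed from gx to gy, must bring back to gx what the
    block sends out of it, whence the sign. *)
Lemma CP5_transfer (K : gedge) (g : edge K -> R) (t : R) :
  (forall z, net_outflow g z = (if gx K == z then t else 0) -
                               (if gy K == z then t else 0)) ->
  (forall e, arc5 1 4%:R (g e)) -> CP5 R K (mod5 (- t)).
Proof.
move=> gt g14.
exists (fun=> true), (fun e => mod5 (if e is Some e' then g e' else - t)).
split=> // [|e]; last exact/arc5_14.
apply/flowE => v; rewrite /net_outflow (bigD1 None) //=.
rewrite (reindex_omap Some id) => [|[]] //=.
rewrite (eq_bigl xpredT) => [|e]; last by rewrite eqxx.
rewrite -[RHS](raddf0 (@mod5 R)).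
transitivity (mod5 ((if gx K == v then - t else 0) -
   (if gy K == v then - t else 0) + net_outflow g v)).
  rewrite raddfD raddfB /= raddf_sum; congr (_ + _).
    by rewrite /edge_outflow /signed /=; congr (_ - _); case: ifP; rewrite ?raddf0.
  apply: eq_bigr => e _; rewrite raddfB /edge_outflow /signed /=.
  by congr (_ - _); case: ifP; rewrite ?raddf0.
congr mod5; rewrite gt.
by case: (gx K == v); case: (gy K == v); ring.
Qed.

Lemma family_circulation (H G : graph) (sigma : edge H -> set (circle5 R))
    (g : edge G -> R) :
  (forall e, symmetric_set (sigma e)) -> in_family sigma G ->
  (forall v, net_outflow g v = 0) -> (forall e, arc5 1 4%:R (g e)) ->
  exists c : edge H -> R,
    (forall v, net_outflow c v = 0) /\ forall e, sigma e (mod5 (c e)).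
Proof.
move=> sym [K [KS iso]] g0 g14.
have [g' [g'0 g'E]] := circulation_iso iso g0.
exists (transfer g'); split=> [|e]; first exact: transfer_circulation.
have := sym e (mod5 (transfer g' e)); rewrite -raddfN /= => ->.
rewrite -KS; apply: (CP5_transfer (net_outflow_block g'0 (e := e))) => k.
have [e' [|]] := g'E (Tagged (fun e => edge (K e)) k); rewrite /block => -> //.
by have := arc5_14_sign true (g e'); rewrite expr1 mulN1r => ->.
Qed.

End Lifting.

(** * Signs along a path of cubic vertices *)

Section Paths.
Variable R : realType.
Variables (H : graph) (c : edge H -> R).

Lemma edge_outflow_signed (e : edge H) (v : vert H) :
  incident e v -> (ends e).1 != (ends e).2 ->
  exists b : bool, edge_outflow c e v = (-1) ^+ b * c e.
Proof.
rewrite /incident /edge_outflow => /orP[]/eqP <-; rewrite eqxx => ne.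
- by exists false; rewrite eq_sym (negPf ne) subr0 mul1r.
- by exists true; rewrite (negPf ne) sub0r mulN1r.
Qed.

Lemma joins_nonloop (e : edge H) u v :
  joins e u v -> u != v -> (ends e).1 != (ends e).2.
Proof. by rewrite /joins => /orP[]/eqP -> //=; rewrite eq_sym. Qed.

(** Count half-edges at v: the non-loops a and b use one each, so a single
    half-edge is left, and the edge e it belongs to is not a loop. *)
Lemma cubic_third_edge (v : vert H) (a b : edge H) :
  degree v = 3%N -> a != b -> incident a v -> incident b v ->
  (ends a).1 != (ends a).2 -> (ends b).1 != (ends b).2 ->
  exists e : edge H, [/\ e != a, e != b, incident e v,
    (ends e).1 != (ends e).2 &
    (forall e', incident e' v -> e' \in [:: a; b; e]) /\
    net_outflow c v = edge_outflow c a v + edge_outflow c b v + edge_outflow c e v].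
Proof.
move=> d3 ab ia ib na nb.
pose m e := (((ends e).1 == v) + ((ends e).2 == v))%N.
have mE e : (m e != 0%N) = incident e v.
  by rewrite /m /incident; do 2 case: (_ == v).
have m1 e : incident e v -> (ends e).1 != (ends e).2 -> m e = 1%N.
  rewrite /m /incident; case: eqP => [->|_]; case: eqP => [->|_] //.
  by rewrite eqxx.
have : (\sum_e m e = 3)%N.
  rewrite -[RHS]d3 /degree big_split /=; congr (_ + _)%N;
    by rewrite -sum1_card [RHS]big_mkcond; apply: eq_bigr => e _; rewrite inE; case: (_ == v).
rewrite (bigD1 a) //= m1 // (bigD1 b) /=; last by rewrite eq_sym.
rewrite m1 // => /eqP; rewrite !eqSS => /eqP s1.
have /existsP[e /and3P[ea eb me]] :
    [exists e, [&& e != a, e != b & m e != 0%N]].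
  rewrite -[[exists _, _]]negbK negb_exists; apply/negP => /forallP h.
  move/eqP: s1; rewrite big1 // => e /andP[ea eb].
  by have := h e; rewrite ea eb /= negbK => /eqP.
move: s1; rewrite (bigD1 e) /=; last by rewrite ea.
move=> s1; have me1 : m e = 1%N by move: me s1; case: (m e) => [|[]].
move/eqP: s1; rewrite me1 eqSS sum_nat_eq0 => /forallP rest0.
have others e' : incident e' v -> e' \in [:: a; b; e].
  rewrite -mE !inE; apply: contraNT; rewrite !negb_or => /and3P[h1 h2 h3].
  by have := rest0 e'; rewrite h1 h2 h3.
exists e; split=> //; first by rewrite -mE.
  apply/negP => /eqP ee; move: me1; rewrite /m ee; by case: (_ == v).
split=> //; rewrite /net_outflow (bigD1 a) //= (bigD1 b) /=; last by rewrite eq_sym.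
rewrite (bigD1 e) /=; last by rewrite ea.
rewrite big1 ?addr0 ?addrA // => e' /andP[/andP[h1 h2] h3].
apply: edge_outflow_nonincident; apply/negP => /others.
by rewrite !inE (negPf h1) (negPf h2) (negPf h3).
Qed.

Hypothesis c0 : forall v, net_outflow c v = 0.
Variable P : gpath H.
Hypothesis c_path : forall e, e \in path_edges P -> arc5 (-1) 1 (c e).
Hypothesis deg3 : forall v, internal P v -> degree v = 3%N.
Hypothesis c_inc : forall e v, internal P v -> incident e v ->
  e \notin path_edges P -> arc5 1 4%:R (c e).

Definition path_flow (i : 'I_(plen P)) : R :=
  edge_outflow c (pedge i) (pvert (widen_ord (leqnSn _) i)).

Lemma pedge_nonloop (i : 'I_(plen P)) :
  (ends (pedge i)).1 != (ends (pedge i)).2.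
Proof.
apply: (joins_nonloop (pedge_joins i)); rewrite (inj_eq (@pvert_inj _ P)).
by rewrite -val_eqE /= /bump /= add1n neq_ltn ltnSn.
Qed.

Lemma pedge_incident (i : 'I_(plen P)) (j : 'I_(plen P).+1) :
  incident (pedge i) (pvert j) -> (j == i :> nat) || (j == i.+1 :> nat).
Proof.
have := pedge_joins i; rewrite /joins /incident => /orP[] /eqP -> /=;
  rewrite !(inj_eq (@pvert_inj _ P)) -!val_eqE /= /bump /= add1n;
  by rewrite ![_ == val j]eq_sym // orbC.
Qed.

Lemma pedge_inj : injective (@pedge _ P).
Proof.
move=> i j ij; apply: val_inj => /=.
have /andP[h1 h2] := joins_incident (pedge_joins i).
rewrite ij in h1 h2; move/pedge_incident: h1; move/pedge_incident: h2.
by rewrite /= /bump /=; lia.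
Qed.

(** The edge leaving the path at v is the only one at v outside the path, so
    conservation reads path_flow i - path_flow j = outflow through that edge,
    to which the trichotomy of signs applies. *)
Lemma path_third_edge (i j : 'I_(plen P)) (v := pvert (widen_ord (leqnSn _) j)) :
  j = i.+1 :> nat ->
  exists b : bool,
    [/\ arc5 0 1 ((-1) ^+ b * path_flow i),
        arc5 0 1 ((-1) ^+ (~~ b) * path_flow j) &
        forall e, incident e v -> e \notin path_edges P ->
          arc5 1 2%:R ((-1) ^+ b * edge_outflow c e v)].
Proof.
move=> ji.
have vE : v = pvert (lift ord0 i).
  by congr pvert; apply: val_inj; rewrite /= /bump /= add1n.
have vint : internal P v.
  by exists (widen_ord (leqnSn _) j) => //=; rewrite ji ltnS leq0n /= -ji.
have /andP[_ ii] := joins_incident (pedge_joins i); rewrite -vE in ii.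
have /andP[ij _] := joins_incident (pedge_joins j).
have ne : pedge i != pedge j.
  by rewrite (inj_eq pedge_inj) -val_eqE /= ji neq_ltn ltnSn.
have [e [ei ej ie nle [others]]] :=
  cubic_third_edge (deg3 vint) ne ii ij (pedge_nonloop i) (pedge_nonloop j).
have eP : e \notin path_edges P.
  apply/imsetP => -[k _ ek]; move: ie; rewrite ek => /pedge_incident /= kj.
  have /orP[/eqP h|/eqP h] : (k == j :> nat) || (k == i :> nat) by lia.
  - by move: ej; rewrite ek (val_inj h) eqxx.
  - by move: ei; rewrite ek (val_inj h) eqxx.
rewrite c0 => cons.
have back : edge_outflow c (pedge i) v = - path_flow i.
  rewrite /path_flow (edge_outflow_joins c (pedge_joins i)) opprK.
  by rewrite vE.
have small k : arc5 (-1) 1 (path_flow k).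
  have /andP[ik _] := joins_incident (pedge_joins k).
  have [b kb] := edge_outflow_signed ik (pedge_nonloop k).
  by rewrite /path_flow kb arc5_41_sign; apply/c_path/imset_f.
have eE : path_flow i - path_flow j = edge_outflow c e v.
  by move: cons; rewrite back -/(path_flow j); lra.
have large : arc5 1 4%:R (path_flow i - path_flow j).
  rewrite eE; have [b ->] := edge_outflow_signed ie nle.
  by rewrite arc5_14_sign; exact: (c_inc vint ie eP).
have [b [bi bj be]] := arc5_split (small i) (small j) large.
exists b; split=> // e' ie' eP'; move: (others _ ie'); rewrite !inE.
case/or3P=> /eqP E; last by rewrite E -eE.
- by case/negP: eP'; rewrite E; apply: imset_f.
- by case/negP: eP'; rewrite E; apply: imset_f.
Qed.

(** The signs of the path values alternate from one edge to the next, hence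
    are given by the parity of the position; the flow leaving the path at an
    internal vertex is tied to the sign of the path edge just before it. *)
Lemma path_alternates :
  exists b : bool, forall (j : 'I_(plen P).+1) (e : edge H),
    (0 < j < plen P)%N -> incident e (pvert j) -> e \notin path_edges P ->
    arc5 1 2%:R ((-1) ^+ (b (+) odd j) * edge_outflow c e (pvert j)).
Proof.
(* q k says that the value on the k-th edge is positive; then (-1) ^+ ~~ q k
   is its sign. *)
pose q (k : 'I_(plen P)) := `[< arc5 0 1 (path_flow k) >].
have qE k (s : bool) : arc5 0 1 ((-1) ^+ s * path_flow k) -> q k = ~~ s.
  move=> h; have uniq_sign (t : bool) : arc5 0 1 ((-1) ^+ t * path_flow k) -> s = t.
    by apply: arc5_sign_inj h; lra.
  apply/asboolP/idP => [h0|/negPf s0].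
    by rewrite (uniq_sign false) // expr0 mul1r.
  by move: h; rewrite s0 expr0 mul1r.
have [b qb] : exists b, forall k, q k = b (+) odd k.
  have [l0|lgt] := posnP (plen P).
    by exists true => -[k kl]; exfalso; rewrite l0 in kl.
  exists (q (Ordinal lgt)) => -[n]; elim: n => [|n IH] nl.
    by rewrite addbF; congr q; apply: val_inj.
  have [b [bi bj _]] := @path_third_edge (Ordinal (ltnW nl)) (Ordinal nl) erefl.
  by rewrite (qE _ _ bj) /= addbN -(IH (ltnW nl)) (qE _ _ bi).
exists b => -[[|n] nl] e /andP[/= n0 np] //.
have -> : pvert (Ordinal nl) = pvert (widen_ord (leqnSn _) (Ordinal np)).
  by congr pvert; apply: val_inj.
have [s [_ sj se]] := @path_third_edge (Ordinal (ltnW np)) (Ordinal np) erefl.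
have -> : b (+) ~~ odd n = s by rewrite -[s]negbK -(qE _ _ sj) qb.
exact: se.
Qed.

End Paths.

Theorem corollary3p7 (R : realType) (H : graph)
    (sigma : edge H -> set (circle5 R))
    (sigma_SI5 : forall e : edge H, SI5 (sigma e))
    (P1 P2 : gpath H)
    (P12_distinct : path_subgraph P1 <> path_subgraph P2)
    (sigma_paths : forall e : edge H,
       e \in path_edges P1 :|: path_edges P2 -> sigma e = int_arc R 4 1)
    (deg_internal : forall v : vert H,
       internal P1 v \/ internal P2 v -> degree v = 3%N)
    (sigma_inc1 : forall (e : edge H) (v : vert H),
       internal P1 v -> incident e v -> e \notin path_edges P1 ->
       sigma e `<=` int_arc R 1 4)
    (sigma_inc2 : forall (e : edge H) (v : vert H),
       internal P2 v -> incident e v -> e \notin path_edges P2 ->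
       sigma e `<=` int_arc R 1 4)
    (odd_connection :
       exists (u1 u2 v1 v2 : vert H) (e1 e2 : edge H) (d1 d2 : nat),
         [/\ internal P1 u1, internal P1 u2, u1 <> u2,
             path_dist P1 u1 u2 d1 & ~~ odd d1] /\
         [/\ internal P2 v1, internal P2 v2, v1 <> v2,
             path_dist P2 v1 v2 d2 & odd d2] /\
         [/\ e1 <> e2,
             e1 \notin path_edges P1 :|: path_edges P2,
             e2 \notin path_edges P1 :|: path_edges P2,
             joins e1 u1 v1 & joins e2 u2 v2]) :
  forall G : graph, in_family sigma G -> (5%:R%:E <= Phi_c R G)%E.
Proof.
move=> G GH; apply/ereal_infP => _ [r [r2 rG] <-].
rewrite lee_fin leNgt; apply/negP => r5.
have [g [g0 g14]] := mod14_circulation r2 r5 rG.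
have sym e : symmetric_set (sigma e) by case: (sigma_SI5 e).
have [c [c0 cs]] := family_circulation sym GH g0 g14.
have c_path e : e \in path_edges P1 :|: path_edges P2 -> arc5 (-1) 1 (c e).
  by move=> /sigma_paths es; apply/arc5_41; rewrite -es.
have [b1 alt1] : exists b : bool, forall (j : 'I_(plen P1).+1) e, _ :=
  @path_alternates R H c c0 P1
    (fun e eP => c_path e (introT setUP (or_introl eP)))
    (fun v iv => deg_internal v (or_introl iv))
    (fun e v iv ie eP => (arc5_14 _).1 (sigma_inc1 e v iv ie eP _ (cs e))).
have [b2 alt2] : exists b : bool, forall (j : 'I_(plen P2).+1) e, _ :=
  @path_alternates R H c c0 P2
    (fun e eP => c_path e (introT setUP (or_intror eP)))
    (fun v iv => deg_internal v (or_intror iv))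
    (fun e v iv ie eP => (arc5_14 _).1 (sigma_inc2 e v iv ie eP _ (cs e))).
have [u1 [u2 [v1 [v2 [e1 [e2 [d1 [d2 [[iu1 iu2 _ pd1 od1]
  [[iv1 iv2 _ pd2 od2] [_ n1 n2 j1 j2]]]]]]]]]]] := odd_connection.
have parity (P : gpath H) (u v : vert H) d : internal P u -> internal P v ->
    path_dist P u v d -> exists i j : 'I_(plen P).+1,
    [/\ (0 < i < plen P)%N, (0 < j < plen P)%N, pvert i = u, pvert j = v
      & odd d = odd i (+) odd j].
  case=> i li <- [j lj <-] [i' [j' [/pvert_inj -> /pvert_inj -> ->]]].
  exists i, j; split=> //; lia.
have [i1 [i2 [li1 li2 pi1 pi2 oi]]] := parity _ _ _ _ iu1 iu2 pd1.
have [k1 [k2 [lk1 lk2 pk1 pk2 ok]]] := parity _ _ _ _ iv1 iv2 pd2.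
(* An edge joining the two paths leaves them with opposite signs. *)
have clash (i : 'I_(plen P1).+1) (k : 'I_(plen P2).+1) e :
    (0 < i < plen P1)%N -> (0 < k < plen P2)%N ->
    e \notin path_edges P1 :|: path_edges P2 -> joins e (pvert i) (pvert k) ->
    b1 (+) odd i = ~~ (b2 (+) odd k).
  move=> li lk; rewrite finset.in_setU negb_or => /andP[nP1 nP2] je.
  have /andP[ii ik] := joins_incident je.
  have := alt1 i e li ii nP1; have := alt2 k e lk ik nP2.
  rewrite (edge_outflow_joins c je) mulrN -mulNr -signrN => h2 h1.
  apply: negb_inj; rewrite negbK; apply: arc5_sign_inj h1 h2 => //.
  by rewrite -natrD ler_nat.
have cl1 := clash i1 k1 e1 li1 lk1 n1; rewrite pi1 pk1 in cl1.
have cl2 := clash i2 k2 e2 li2 lk2 n2; rewrite pi2 pk2 in cl2.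
move: (cl1 j1) (cl2 j2) od1 od2; rewrite oi ok.
by case: (odd i1); case: (odd i2); case: (odd k1); case: (odd k2); 
  case: (b1); case: (b2).
Qed.
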